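(* Let $F$ be a finite field and $n$ a positive integer. Then the unitary Cayley graph $\Gamma(M_n(F))$ of the ring $M_n(F)$ of $n\times n$ matrices over $F$ is well-covered if and only if $n\leq 2$.
   Context: For a finite ring $R$ (associative, with nonzero identity), the unitary Cayley graph $\Gamma(R)$ is the simple undirected graph with vertex set $R$ in which two distinct vertices $x,y$ are adjacent if and only if $x-y$ is a unit of $R$. A graph is well-covered if all its maximal independent sets have the same cardinality. *)

(* Defs.v *)
From mathcomp Require Import all_boot all_order all_algebra.

Set Implicit Arguments.
Unset Strict Implicit.
Unset Printing Implicit Defensive.

Import GRing.Theory.

Local Open Scope ring_scope.

(* A finite simple graph is given by its adjacency relation, a symmetric and
   irreflexive relation on a finite type. *)

Definition independent (V : finType) (e : rel V) (S : {set V}) : bool :=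
  [forall x in S, forall y in S, ~~ e x y].

(* Maximality is with respect to inclusion. *)
Definition maximal_independent (V : finType) (e : rel V) (S : {set V}) : bool :=
  maxset (independent e) S.

Definition well_covered (V : finType) (e : rel V) : Prop :=
  forall S T : {set V},
    maximal_independent e S -> maximal_independent e T -> #|S| = #|T|.

(* A finUnitRingType is a finite, possibly noncommutative, ring with 1 != 0
   whose GRing.unit is exactly the set of two-sided invertible elements. *)
Definition unitary_cayley (R : finUnitRingType) : rel R :=
  fun x y => (x != y) && (x - y \is a GRing.unit).

Lemma unitary_cayley_sym (R : finUnitRingType) : symmetric (@unitary_cayley R).
Proof. by move=> x y; rewrite /unitary_cayley eq_sym -opprB unitrN. Qed.

Lemma unitary_cayley_irr (R : finUnitRingType) :
  irreflexive (@unitary_cayley R).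
Proof. by move=> x; rewrite /unitary_cayley eqxx. Qed.

(* Main.v *)
(** Two independent sets of different sizes settle the case of size [m >= 3]:
    the matrices vanishing on a block [I x J] with [#|I| + #|J| = m + 1] are all
    singular, and they form a maximal independent set because the entries off
    the block can be chosen to make any matrix that is nonzero on the block
    invertible.  Its size is [q ^ (m ^ 2 - #|I| * #|J|)], and the blocks
    [1 x m] and [2 x (m - 1)] have different areas as soon as [m >= 3].
    In size 2, an independent set has pairwise differences of rank at most 1,
    which forces them all to share a column space or all to share a row space;
    hence a maximal one is a translate of [u * F^2] or [F^2 * v]. *)

Require Import Defs.
From mathcomp Require Import all_boot all_order all_algebra all_fingroup.
From mathcomp Require Import zify.

Set Implicit Arguments.
Unset Strict Implicit.
Unset Printing Implicit Defensive.

Import GRing.Theory.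

Local Open Scope ring_scope.

Section UnitaryCayley.

Variable F : finFieldType.

(** * Independent sets of matrices *)

Lemma independentP n (S : {set 'M[F]_n.+1}) :
  reflect {in S &, forall A B, A - B \notin unitmx}
          (independent (@unitary_cayley 'M[F]_n.+1) S).
Proof.
apply: (iffP 'forall_in_forall_inP) => [indS A B SA SB | indS A SA B SB].
  have := indS A SA B SB; rewrite /unitary_cayley negb_and negbK.
  by case/orP=> [/eqP->|//]; rewrite subrr -[_ \in _]/(0 \is a GRing.unit) unitr0.
by rewrite /unitary_cayley negb_and; apply/orP; right; apply: indS.
Qed.

(** The empty set extends to the independent set [[set 0]]. This supplies a base point in sizes 1
    and 2. *)
Lemma maximal_independent_neq0 n (S : {set 'M[F]_n.+1}) :
  maximal_independent (@unitary_cayley 'M[F]_n.+1) S -> S != set0.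
Proof.
move=> /maxsetP[_ maxS]; apply/negP => /eqP S0.
have /maxS/(_ _)-E : independent (@unitary_cayley 'M[F]_n.+1) [set 0].
  apply/independentP => A B /set1P-> /set1P->.
  by rewrite subrr -[_ \in _]/(0 \is a GRing.unit) unitr0.
have := set11 (0 : 'M[F]_n.+1).
by rewrite E ?S0 ?sub0set // inE.
Qed.

(** * Matrices vanishing on a block *)

Definition zero_block n (I J : {set 'I_n}) : {set 'M[F]_n} :=
  [set A : 'M[F]_n | [forall i in I, forall j in J, A i j == 0]].

Lemma zero_blockP n (I J : {set 'I_n}) (A : 'M[F]_n) :
  reflect {in I & J, forall i j, A i j = 0} (A \in zero_block I J).
Proof.
rewrite inE; apply: (iffP 'forall_in_forall_inP) => [A0 i j Ii Jj | A0 i Ii j Jj].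
  exact/eqP/A0.
exact/eqP/A0.
Qed.

Lemma card_zero_block n (I J : {set 'I_n}) :
  #|zero_block I J| = (#|F| ^ (n * n - #|I| * #|J|))%N.
Proof.
pose D := ~: setX I J.
pose h (f : {ffun 'I_n * 'I_n -> F}) : 'M[F]_n := \matrix_(i, j) f (i, j).
have h_inj : injective h.
  move=> f g /matrixP fg; apply/ffunP => -[i j].
  by have := fg i j; rewrite !mxE.
(* Read as functions on positions, these matrices are those with support in the complement [D] of
   the block, which [pffun_on] counts. *)
have -> : zero_block I J = h @: pffun_on 0 (mem D) predT.
  apply/setP => A; apply/zero_blockP/imsetP => [A0 | [f fD ->] i j Ii Jj].
    exists [ffun ij => A ij.1 ij.2]; last by apply/matrixP=> i j; rewrite mxE ffunE.
    apply/pffun_onP; split=> //; apply/subsetP=> -[i j].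
    rewrite !inE ffunE /=; apply: contraNN => /andP[Ii Jj].
    exact/eqP/A0.
  rewrite mxE; apply/eqP; apply: contraTT fD => fij.
  apply/negP => /pffun_onP[/subsetP/(_ (i, j)) + _].
  by rewrite inE fij !inE Ii Jj => /(_ isT).
have cardD : #|D| = (n * n - #|I| * #|J|)%N.
  by rewrite cardsCs setCK card_prod card_ord cardsX.
by rewrite card_imset // card_pffun_on -cardD.
Qed.

(* By pigeonhole every term of the Leibniz expansion meets the block. *)
Lemma zero_block_singular n (I J : {set 'I_n}) (A : 'M[F]_n) :
  (n < #|I| + #|J|)%N -> A \in zero_block I J -> A \notin unitmx.
Proof.
move=> ltn /zero_blockP A0; rewrite unitmxE /determinant big1 ?unitr0 // => s _.
have [i Ii Ji] : exists2 i, i \in I & s i \in J.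
  apply/exists_inP; apply: contraLR ltn; rewrite -leqNgt negb_exists_in.
  move=> /forall_inP IJ.
  have sub : s @: I \subset ~: J.
    by apply/subsetP=> _ /imsetP[i Ii ->]; rewrite inE IJ.
  have := subset_leq_card sub; rewrite card_imset; last exact: perm_inj.
  by have := cardsC J; rewrite card_ord; lia.
by rewrite (bigD1 i) //= A0 // mul0r mulr0.
Qed.

(** [C] copies [B] on the block and the permutation matrix of [s] elsewhere. The condition on [s]
    makes it triangular enough for its left kernel to vanish. *)
Lemma zero_block_completion n (I J : {set 'I_n}) (B : 'M[F]_n) (s : 'S_n) i0 :
    i0 \in I -> s i0 \in J -> B i0 (s i0) != 0 ->
    (forall i, i != i0 -> (i \in I) = (s i \notin J)) ->
  exists2 C, C \in unitmx & B - C \in zero_block I J.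
Proof.
move=> Ii0 Jj0 B0 sIJ.
pose C := \matrix_(i, j) if (i \in I) && (j \in J) then B i j else (s i == j)%:R.
exists C; last first.
  by apply/zero_blockP => i j Ii Jj; rewrite !mxE Ii Jj subrr.
rewrite -row_free_unit -kermx_eq0; apply/eqP/row_matrixP => k; rewrite row0.
have : row k (kermx C) *m C = 0 by apply: sub_kermxP; exact: row_sub.
move: (row k _) => v vC.
have vCj j : \sum_i v 0 i * C i j = 0.
  by have /rowP/(_ j) := vC; rewrite !mxE.
(* The kernel vector is killed in three rounds: on [I] minus [i0], where column [s i] lies outside
   [J] and holds a single 1; at [i0], through the entry [B i0 (s i0)]; then off [I]. *)
have v_in i : i != i0 -> i \in I -> v 0 i = 0.
  move=> ni Ii; have Ji : s i \notin J by rewrite -sIJ.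
  have := vCj (s i); rewrite (bigD1 i) //= big1.
    by rewrite [C _ _]mxE (negPf Ji) andbF eqxx mulr1 addr0.
  move=> l nl; rewrite [C _ _]mxE (negPf Ji) andbF (inj_eq perm_inj) (negPf nl).
  by rewrite mulr0.
have v_i0 : v 0 i0 = 0.
  have := vCj (s i0); rewrite (bigD1 i0) //= big1.
    by rewrite addr0 [C _ _]mxE Ii0 Jj0 => /eqP; rewrite mulf_eq0 (negPf B0) orbF => /eqP.
  move=> l nl; have [Il|nIl] := boolP (l \in I); first by rewrite v_in // mul0r.
  by rewrite [C _ _]mxE (negPf nIl) (inj_eq perm_inj) (negPf nl) mulr0.
apply/rowP => i; rewrite [RHS]mxE.
have [->//|ni] := eqVneq i i0.
have [Ii|nIi] := boolP (i \in I); first exact: v_in.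
have := vCj (s i); rewrite (bigD1 i) //= big1.
  by rewrite addr0 [C _ _]mxE (negPf nIi) eqxx mulr1.
move=> l nl; have [Il|nIl] := boolP (l \in I).
  by have [->|nl0] := eqVneq l i0; rewrite ?v_i0 ?v_in // mul0r.
by rewrite [C _ _]mxE (negPf nIl) (inj_eq perm_inj) (negPf nl) mulr0.
Qed.

(** If [B] is nonzero at a position of the block, completion yields an invertible [C] with [B - C]
    in the set, so [B] is adjacent to [B - C] and cannot be added. *)
Lemma zero_block_maximal n (I J : {set 'I_n.+1}) :
    (n.+1 < #|I| + #|J|)%N ->
    (forall i0 j0, i0 \in I -> j0 \in J -> exists2 s : 'S_n.+1, s i0 = j0 &
       forall i, i != i0 -> (i \in I) = (s i \notin J)) ->
  maximal_independent (@unitary_cayley 'M[F]_n.+1) (zero_block I J).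
Proof.
move=> ltIJ permIJ; apply/maxsetP; split.
  apply/independentP => A B /zero_blockP A0 /zero_blockP B0.
  apply: (zero_block_singular ltIJ); apply/zero_blockP => i j Ii Jj.
  by rewrite !mxE A0 // B0 // subrr.
move=> S /independentP indS /subsetP sub; apply/eqP; rewrite eqEsubset.
apply/andP; split; last exact/subsetP.
apply/subsetP=> B SB; apply/zero_blockP => i0 j0 Ii0 Jj0.
apply/eqP/negP => /negP B0; have [s sE sIJ] := permIJ _ _ Ii0 Jj0.
rewrite -sE in Jj0 B0.
have [C uC /sub SBC] := zero_block_completion Ii0 Jj0 B0 sIJ.
by have := indS _ _ SB SBC; rewrite subKr uC.
Qed.

(** * Two maximal sets of different sizes *)

Lemma zero_row_maximal n :
  maximal_independent (@unitary_cayley 'M[F]_n.+1) (zero_block [set ord0] setT).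
Proof.
apply: zero_block_maximal; first by rewrite cards1 cardsT card_ord.
move=> i0 j0 /set1P-> _; exists (tperm ord0 j0); first by rewrite tpermL.
by move=> i /negPf ni; rewrite !inE ni.
Qed.

Lemma zero_two_rows_maximal n :
  maximal_independent (@unitary_cayley 'M[F]_n.+2)
    (zero_block [set ord0; ord_max] [set~ ord0]).
Proof.
have n0m : ord0 != ord_max :> 'I_n.+2 by [].
apply: zero_block_maximal.
  by rewrite cards2 n0m cardsC1 card_ord.
move=> i0 j0 Ii0; rewrite !inE => nj0.
have [i1 ni1 IE] : exists2 i1, i1 != i0 & [set ord0; ord_max] = [set i0; i1].
  case/set2P: Ii0 => ->; first by exists ord_max; rewrite // eq_sym.
  by exists ord0; rewrite // setUC.
(* The permutation must send [i0] to [j0] and the other row [i1] to [ord0], the only column outside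
   the block. [t] settles [i1]; the second transposition then moves [t i0] to [j0] and fixes
   [ord0]. *)
pose t := tperm i1 (ord0 : 'I_n.+2).
exists (t * tperm (t i0) j0)%g; first by rewrite permM tpermL.
have ti1 : (t * tperm (t i0) j0)%g i1 = ord0.
  rewrite permM tpermL tpermD //.
  by rewrite -(tpermL i1 ord0) (inj_eq perm_inj) eq_sym.
move=> i ni; rewrite IE !inE negbK (negPf ni) /=.
by rewrite -[in RHS]ti1 (inj_eq perm_inj).
Qed.

Lemma not_well_covered n :
  ~ well_covered (@unitary_cayley 'M[F]_n.+3).
Proof.
move=> /(_ _ _ (zero_row_maximal _) (zero_two_rows_maximal _)).
rewrite !card_zero_block cards1 cardsT cards2 cardsC1 !card_ord /=.
(* As [#|F| > 1], the exponents agree, so the areas [m] and [2 * (m - 1)] agree for [m = n + 3],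
   which is impossible. *)
by move/eqP; rewrite eqn_exp2l ?card_finNzRing_gt1 //; nia.
Qed.

(** * Size 1: a complete graph *)

Lemma well_covered_size1 : well_covered (@unitary_cayley 'M[F]_1).
Proof.
suff card1 (S : {set 'M[F]_1}) :
    maximal_independent (@unitary_cayley 'M[F]_1) S -> #|S| = 1%N.
  by move=> S T /card1-> /card1->.
move=> maxS; have /set0Pn[A SA] := maximal_independent_neq0 maxS.
have /maxsetP[/independentP indS _] := maxS.
apply/eqP/cards1P; exists A; apply/setP => B; rewrite inE.
apply/idP/eqP => [SB | ->//]; apply/eqP; rewrite -subr_eq0.
(* A nonzero 1 x 1 matrix has full rank, so distinct elements of [S] would be adjacent. *)
apply: contraNT (indS _ _ SB SA) => nz.
by rewrite -row_free_unit /row_free rank_rV nz.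
Qed.

(** * Size 2: translates of spaces of matrices of rank at most 1 *)

Definition col_translate m n (A : 'M[F]_(m, n)) (u : 'cV[F]_m) :=
  [set A + u *m v | v : 'rV[F]_n].

Definition row_translate m n (A : 'M[F]_(m, n)) (v : 'rV[F]_n) :=
  [set A + u *m v | u : 'cV[F]_m].

Lemma card_col_translate m n (A : 'M[F]_(m, n)) u :
  u != 0 -> #|col_translate A u| = (#|F| ^ n)%N.
Proof.
move=> nz; rewrite card_imset ?card_mx ?mul1n // => v w /addrI uvw.
have fu : row_free u^T by rewrite /row_free rank_rV trmx_eq0 nz.
apply: trmx_inj; apply: (row_free_inj fu).
by rewrite -!trmx_mul uvw.
Qed.

Lemma card_row_translate m n (A : 'M[F]_(m, n)) v :
  v != 0 -> #|row_translate A v| = (#|F| ^ m)%N.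
Proof.
move=> nz; rewrite card_imset ?card_mx ?muln1 // => u w /addrI.
by apply: row_free_inj; rewrite /row_free rank_rV nz.
Qed.

Lemma rank1_singular n (u : 'cV[F]_n.+2) (v : 'rV[F]_n.+2) :
  u *m v \notin unitmx.
Proof.
rewrite -row_free_unit /row_free; apply/negP => /eqP r.
by have := leq_trans (mxrankM_maxl u v) (rank_leq_col u); rewrite r.
Qed.

Lemma col_translate_independent n (A : 'M[F]_n.+2) u :
  independent (@unitary_cayley 'M[F]_n.+2) (col_translate A u).
Proof.
apply/independentP => _ _ /imsetP[v _ ->] /imsetP[w _ ->].
by rewrite [A + _]addrC addrKA -mulmxBr rank1_singular.
Qed.

Lemma row_translate_independent n (A : 'M[F]_n.+2) v :
  independent (@unitary_cayley 'M[F]_n.+2) (row_translate A v).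
Proof.
apply/independentP => _ _ /imsetP[u _ ->] /imsetP[w _ ->].
by rewrite [A + _]addrC addrKA -mulmxBl rank1_singular.
Qed.

(** The row [v] already has rank 1, so the sum of the two spans is the span of [v]. *)
Lemma adds_rV_rank_le1 n (z v : 'rV[F]_n) :
  (\rank (z + v)%MS <= 1)%N -> v != 0 -> exists a, z = a *: v.
Proof.
move=> le1 nz; apply/sub_rVP.
have [ge1 eq_sub] := mxrank_leqif_sup (addsmxSr z v).
have : (z + v <= v)%MS by rewrite -eq_sub eqn_leq ge1 rank_rV nz.
by rewrite addsmx_sub => /andP[].
Qed.

(** The difference is a product of two 2 x 2 matrices, with columns [w], [u] and rows [z], [-v]; one
    of them must be singular. *)
Lemma sub_rank1_singular (w u : 'cV[F]_2) (z v : 'rV[F]_2) :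
    w *m z - u *m v \notin unitmx ->
  (\rank (w^T + u^T)%MS <= 1)%N \/ (\rank (z + v)%MS <= 1)%N.
Proof.
have -> : w *m z - u *m v = (row_mx w u : 'M_2) *m (col_mx z (- v) : 'M_2).
  by rewrite -mulmxN -mul_row_col.
rewrite unitmx_mul negb_and -!row_free_unit /row_free => /orP[] r; [left|right].
  rewrite addsmxE -tr_row_mx mxrank_tr -ltnS ltn_neqAle r; exact: rank_leq_row.
rewrite -(adds_eqmx (eqmx_refl z) (eqmx_opp v)) addsmxE -ltnS ltn_neqAle r.
exact: rank_leq_row.
Qed.

Lemma singular_rank1 (A : 'M[F]_2) :
  A \notin unitmx -> exists u : 'cV_2, exists v : 'rV_2, A = u *m v.
Proof.
rewrite -row_free_unit /row_free => r.
have : (\rank A < 2)%N by rewrite ltn_neqAle r rank_leq_row.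
move: (col_base A) (row_base A) (mulmx_base A).
case: (\rank A) => [|[|//]] u v uv _; last by exists u, v.
(* In rank 0 the factors have inner dimension 0, so zero vectors replace them. *)
by exists 0, 0; rewrite -uv mulmx0 thinmx0 mul0mx.
Qed.

Lemma independent_size2 (S : {set 'M[F]_2}) (A : 'M[F]_2) :
    independent (@unitary_cayley 'M[F]_2) S -> A \in S ->
  (exists2 u, u != 0 & S \subset col_translate A u) \/
  (exists2 v, v != 0 & S \subset row_translate A v).
Proof.
move=> /independentP indS SA.
have [/exists_inP[B SB nBA] | ] := boolP [exists B in S, B != A]; last first.
  (* Here [S] is the singleton of [A], and any nonzero direction serves. *)
  rewrite negb_exists_in => /forall_inP SE; left; exists (const_mx 1).
    by apply/eqP => /matrixP/(_ 0 0)/eqP; rewrite !mxE oner_eq0.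
  apply/subsetP => B /SE; rewrite negbK => /eqP->.
  by apply/imsetP; exists 0; rewrite // mulmx0 addr0.
have [u [v BA]] := singular_rank1 (indS _ _ SB SA).
have nu : u != 0.
  by apply: contraNneq nBA => u0; rewrite -subr_eq0 BA u0 mul0mx.
have nv : v != 0.
  by apply: contraNneq nBA => v0; rewrite -subr_eq0 BA v0 mulmx0.
have col_mem C (w : 'cV_2) z : C = A + w *m z -> (\rank (w^T + u^T)%MS <= 1)%N ->
    C \in col_translate A u.
  move=> -> /adds_rV_rank_le1[|a wE]; first by rewrite trmx_eq0.
  apply/imsetP; exists (a *: z) => //.
  by rewrite -[w]trmxK wE linearZ /= trmxK -scalemxAl -scalemxAr.
have row_mem C (w : 'cV_2) z : C = A + w *m z -> (\rank (z + v)%MS <= 1)%N ->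
    C \in row_translate A v.
  move=> -> /adds_rV_rank_le1[//|a ->].
  by apply/imsetP; exists (a *: w); rewrite // -scalemxAl -scalemxAr.
(* Comparing [C - A = w *m z] with [B - A = u *m v] through the singular [C - B] makes [w], [u] or
   [z], [v] proportional. *)
have col_or_row C : C \in S -> C \in col_translate A u \/ C \in row_translate A v.
  move=> SC; have [w [z /(canRL (subrK _))]] := singular_rank1 (indS _ _ SC SA).
  rewrite addrC => CE; have := indS _ _ SC SB.
  rewrite -(subrKA A) -[A - B]opprB BA {1}CE [A + _]addrC addrK.
  by case/sub_rank1_singular; [left; apply: col_mem CE _ | right; apply: row_mem CE _].
have [subS | /subsetPn[C SC nC]] := boolP (S \subset col_translate A u).
  by left; exists u.
(* With [C = A + w *m v] outside the column translate, any [E = A + u *m z] in [S] is compared with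
   [C]: [w] proportional to [u] is excluded, so [z] is proportional to [v]. *)
right; exists v => //; apply/subsetP => E SE.
have [/imsetP[z _ EE] | //] := col_or_row E SE.
have [| /imsetP[w _ CE]] := col_or_row C SC; first by rewrite (negPf nC).
have := indS _ _ SC SE; rewrite {1}CE {1}EE [A + _]addrC addrKA.
case/sub_rank1_singular => [r | ].
  by case/negP: nC; apply: col_mem CE r.
by rewrite addsmxC; apply: row_mem EE.
Qed.

(** Translates are independent, so a maximal [S] equals the one containing it; both kinds have
    [#|F| ^ 2] elements. *)
Lemma well_covered_size2 : well_covered (@unitary_cayley 'M[F]_2).
Proof.
suff cardS (S : {set 'M[F]_2}) :
    maximal_independent (@unitary_cayley 'M[F]_2) S -> #|S| = (#|F| ^ 2)%N.
  by move=> S T /cardS-> /cardS->.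
move=> maxS; have /set0Pn[A SA] := maximal_independent_neq0 maxS.
have /maxsetP[indS maxE] := maxS.
have [[u nu] | [v nv]] := independent_size2 indS SA.
  move=> /(maxE _ (col_translate_independent A u)) <-.
  exact: card_col_translate.
move=> /(maxE _ (row_translate_independent A v)) <-.
exact: card_row_translate.
Qed.

End UnitaryCayley.

Local Close Scope ring_scope.

(* The size is n.+1, i.e. an arbitrary positive integer: the library gives
   square matrices a (nonzero) ring structure only in this form. *)
Theorem theorem2p6 (F : finFieldType) (n : nat) :
  well_covered (@unitary_cayley 'M[F]_n.+1) <-> n.+1 <= 2.
Proof.
case: n => [|[|n]]; split=> //.
- by move=> _; apply: well_covered_size1.
- by move=> _; apply: well_covered_size2.
- by move/not_well_covered.
Qed.
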